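(* The number of antichains in $\{0,1,2\}^n$ is $2^{\left(1+O\left(\sqrt{\log{n}/n}\right)\right)\ell_n(n)}$ as $n\to\infty$.
   Context: $\{0,1,2\}^n$ is the poset in which $x\leq y$ if and only if $x_j\leq y_j$ for all $1\leq j\leq n$. For $0\leq i\leq 2n$, $\ell_i(n)$ denotes the number of vectors in $\{0,1,2\}^n$ whose coordinates sum to $i$. An antichain is a set of pairwise incomparable elements. *)

(* Defs.v *)
From mathcomp Require Import all_boot.
From Stdlib Require Import Reals.

Set Implicit Arguments.
Unset Strict Implicit.
Unset Printing Implicit Defensive.

Definition cube3 (n : nat) := {ffun 'I_n -> 'I_3}.

Definition cle (n : nat) (x y : cube3 n) : bool :=
  [forall j : 'I_n, (nat_of_ord (x j) <= nat_of_ord (y j))%N].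

Definition antichain (n : nat) (S : {set cube3 n}) : bool :=
  [forall x in S, forall y in S, (x != y) ==> ~~ cle x y].

Definition num_antichains (n : nat) : nat :=
  #|[set S : {set cube3 n} | antichain S]|.

Definition ell (i n : nat) : nat :=
  #|[set x : cube3 n | (\sum_(j < n) nat_of_ord (x j))%N == i]|.

(* Main.v *)
(* Greene-Kleitman bracket matching partitions the cube into ell_n(n) chains.
   Averaging this partition over the n! coordinate permutations gives a strong
   supersaturation: a family F of points with at least 2q ~ n/8 zeros and as many
   ones has a member comparable to at least q (|F| / ell_n(n) - 1) others.
   Deciding whether such a member v lies in an antichain yields
   a(F) <= a(F - v) + a(F - v - N(v)), hence a(F) <= prod_(m <= |F|) (1 + b_m) as
   soon as b_m (1 + b_m)^d >= 1, where d is the degree guaranteed at size m.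
   With b_m = 1 up to about ell + A and b_m = A / (m - ell) afterwards, where
   A = 6 ell log n / q, the product is about 2^(ell + A) * n^(2A): the relative error is
   O(log^2 n / n). The remaining points are exponentially few. *)

Require Import Defs.
From Stdlib Require Import ZArith Reals Lra.
From mathcomp Require Import all_boot all_fingroup.
From mathcomp Require Import zify.

Set Implicit Arguments.
Unset Strict Implicit.
Unset Printing Implicit Defensive.

(** * Symmetric chains *)

(* The letter [i] stands for [i] closing brackets followed by [2 - i] opening ones;
   the head of the list is the last letter read. [brackets] counts the unmatched
   closing and opening brackets, and [matching] how many brackets each letter closes. *)
Fixpoint brackets (s : seq nat) : nat * nat :=
  if s is i :: s' then
    let: (c, o) := brackets s' in (c + (i - o), (o - i) + (2 - i))
  else (0, 0).

Fixpoint matching (s : seq nat) : seq nat :=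
  if s is i :: s' then minn i (brackets s').2 :: matching s' else [::].

Definition ternary (s : seq nat) := all (fun i => i <= 2) s.

Lemma size_matching s : size (matching s) = size s.
Proof. by elim: s => //= i s ->. Qed.

(** Each letter carries two brackets and each matched pair uses up two, so the number of unmatched
    brackets depends only on [matching s]. *)
Lemma brackets_sum s : ternary s ->
  (brackets s).1 + (brackets s).2 + 2 * sumn (matching s) = 2 * size s.
Proof.
elim: s => //= i s IH /andP[hi /IH]; case: (brackets s) => c o /=.
by rewrite /minn; case: ltnP; lia.
Qed.

Lemma closers_sum s : (brackets s).1 + sumn (matching s) = sumn s.
Proof.
elim: s => //= i s; case: (brackets s) => c o /=.
by rewrite /minn; case: ltnP; lia.
Qed.

(** With equal matchings the unmatched totals agree, at every stage of the reading. A tail with more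
    unmatched closers has fewer openers available, so [c > c'] would force the head letters to match
    different numbers. Hence [c <= c'], then [i <= i'], and the comparison passes to the tails. *)
Lemma matching_chain s s' : ternary s -> ternary s' ->
  matching s = matching s' -> (brackets s).1 <= (brackets s').1 ->
  forall j, nth 0 s j <= nth 0 s' j.
Proof.
elim: s s' => [|i s IH] [|i' s'] //= /andP[hi hs] /andP[hi' hs'] [e1 e2].
have := brackets_sum hs; have := brackets_sum hs'; have := IH _ hs hs' e2.
have := congr1 size e2; rewrite !size_matching e2 => ->.
case: (brackets s) (brackets s') e1 => c o [c' o'] /= e1 IHs k k' le.
have [lc li] : c <= c' /\ i <= i'.
  by move: (sumn _) (size _) e1 k k' le => a b; lia.
by case=> [|j] //=; apply: IHs.
Qed.

(** Unmatched brackets can be reoriented without touching the matched ones, provided that the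
    closers come first. So each class of the matching reaches every possible number of unmatched
    closers. *)
Lemma matching_full s q : ternary s -> q <= (brackets s).1 + (brackets s).2 ->
  exists2 s', ternary s' & matching s' = matching s /\ (brackets s').1 = q.
Proof.
elim: s q => [|i s IH] q /=.
  by move=> _; rewrite leqn0 => /eqP ->; exists [::].
case/andP=> hi hs; have := brackets_sum hs; have := IH _ hs.
case E: (brackets s) => [c o] /= {}IH k hq.
pose t := minn i o; have ht : t <= i /\ t <= o by rewrite /t; lia.
have hq' : q + t + t <= c + o + 2 by move: hq; rewrite /t /minn; case: ltnP; lia.
(* The tail takes as many of the [q] closers as it can while keeping [t] openers for the head
   letter; the head letter takes the rest, besides its [t] matched closers. *)
have [|s' hs' [m' c']] := IH (minn q (c + o - t)); first by lia.
exists ((q + t - minn q (c + o - t)) :: s').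
  by rewrite /= hs' andbT /minn; case: ltnP; lia.
have := brackets_sum hs'; have := congr1 size m'; rewrite !size_matching m' => -> k'.
rewrite /= m'; move: c' k'; case: (brackets s') => c1 o1 /= -> k'.
have e : minn q (c + o - t) + o1 = c + o by lia.
split; last by move: ht hq' e; clear; lia.
congr cons; rewrite -/t.
by clearbody t; move: ht hq' e; clear; lia.
Qed.

Definition rank n (x : cube3 n) := \sum_(j < n) nat_of_ord (x j).

Definition word n (x : cube3 n) : seq nat := [seq val (x i) | i <- enum 'I_n].

Lemma size_word n (x : cube3 n) : size (word x) = n.
Proof. by rewrite size_map size_enum_ord. Qed.

Lemma nth_word n (x : cube3 n) (j : 'I_n) : nth 0 (word x) j = x j.
Proof. by rewrite (nth_map j) ?size_enum_ord // nth_ord_enum. Qed.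

Lemma ternary_word n (x : cube3 n) : ternary (word x).
Proof. by apply/allP => _ /mapP[i _ ->]; exact: (ltn_ord (x i)). Qed.

Lemma sumn_word n (x : cube3 n) : sumn (word x) = rank x.
Proof. by rewrite sumnE big_map big_enum. Qed.

Lemma word_surj n s : size s = n -> ternary s -> exists x : cube3 n, word x = s.
Proof.
move=> sz ht; exists [ffun i : 'I_n => inord (nth 0 s i)].
apply: (@eq_from_nth _ 0); first by rewrite size_word.
move=> j; rewrite size_word => hj.
rewrite -[j in LHS]/(nat_of_ord (Ordinal hj)) nth_word ffunE inordK //.
by rewrite ltnS; apply: (allP ht); rewrite mem_nth ?sz.
Qed.

Lemma cle_antirank n (x y : cube3 n) : cle x y -> rank x = rank y -> x = y.
Proof.
move=> /forallP le e; apply/ffunP => j; apply/val_inj/eqP => /=.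
have /eqP := e; rewrite /rank.
rewrite (leqif_sum (fun i _ => leqif_eq (le i))) => /forallP/(_ j).
by move/implyP; apply.
Qed.

(** A partition into [ell n n] chains, encoded by sending each point to the middle-rank point of its
    chain. *)
Definition chain_map n (phi : cube3 n -> cube3 n) :=
  (forall x, rank (phi x) = n) /\
  (forall x y, phi x = phi y -> cle x y || cle y x).

Lemma chain_map_exists n : exists phi, @chain_map n phi.
Proof.
pose Q (x y : cube3 n) := (matching (word y) == matching (word x)) && (rank y == n).
have exQ x : exists y, Q x y.
  have hk := brackets_sum (ternary_word x).
  (* By [closers_sum], the rank is the number of unmatched closers plus the number of matched pairs;
     this choice makes it [n]. *)
  have [|s hs [m c]] := @matching_full (word x)
      (n - sumn (matching (word x))) (ternary_word x).
    by move: hk; rewrite size_word; lia.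
  have sz : size s = n by rewrite -size_matching m size_matching size_word.
  have [y ey] := word_surj sz hs; exists y; rewrite /Q ey m eqxx /=.
  have := closers_sum s; rewrite -sumn_word ey m c => <-.
  by apply/eqP; move: hk; rewrite size_word; lia.
exists (fun x => xchoose (exQ x)); split=> [x|x y exy].
  by case/andP: (xchooseP (exQ x)) => _ /eqP.
have /andP[/eqP mx _] := xchooseP (exQ x).
have /andP[/eqP my _] := xchooseP (exQ y).
have e : matching (word x) = matching (word y) by rewrite -mx -my exy.
have [l|/ltnW l] := leqP (brackets (word x)).1 (brackets (word y)).1.
  apply/orP; left; apply/forallP => j; rewrite -!nth_word.
  by apply: matching_chain; rewrite ?ternary_word.
apply/orP; right; apply/forallP => j; rewrite -!nth_word.
by apply: matching_chain; rewrite ?ternary_word.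
Qed.

(** * Supersaturation *)

Definition permute n (x : cube3 n) (s : 'S_n) : cube3 n := [ffun j => x (s j)].

Lemma permuteM n (x : cube3 n) (s t : 'S_n) :
  permute x (s * t)%g = permute (permute x t) s.
Proof. by apply/ffunP => j; rewrite !ffunE permM. Qed.

Lemma permute_inj n (s : 'S_n) : injective (fun x : cube3 n => permute x s).
Proof.
move=> x y /ffunP e; apply/ffunP => j.
by have := e ((s^-1)%g j); rewrite !ffunE permKV.
Qed.

Lemma rank_permute n (x : cube3 n) (s : 'S_n) : rank (permute x s) = rank x.
Proof.
rewrite /rank [RHS](reindex_inj (@perm_inj _ s)).
by apply: eq_bigr => j _; rewrite ffunE.
Qed.

Lemma cle_permute n (x y : cube3 n) (s : 'S_n) :
  cle (permute x s) (permute y s) = cle x y.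
Proof.
apply/forallP/forallP => le j; last by rewrite !ffunE.
by have := le ((s^-1)%g j); rewrite !ffunE permKV.
Qed.

(** Transpositions inside [Z] fix [x]. If [y] takes the value [v] at [q] or more positions of [Z],
    swapping [b] with each of them gives distinct images of [y]. Otherwise at least [q] positions of
    [Z] carry other values, and swapping [a] with each of them does. *)
Lemma stabilizer_moves n (x y : cube3 n) (Z : {set 'I_n}) (v : 'I_3) q a b :
  {in Z &, forall i j, x i = x j} -> a \in Z -> b \in Z -> y a = v -> y b != v ->
  2 * q <= #|Z| ->
  exists (J : {set 'I_n}) (s : 'I_n -> 'S_n),
    [/\ q <= #|J|, forall j, j \in J -> permute x (s j) = x
      & {in J &, injective (fun j => permute y (s j))}].
Proof.
move=> xZ aZ bZ ya yb cZ.
have fixx c : c \in Z -> {in Z, forall j, permute x (tperm c j) = x}.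
  move=> cZ' j jZ; apply/ffunP => k; rewrite ffunE.
  by case: tpermP => [->|->|//]; apply: xZ.
pose A := Z :&: [set i | y i == v].
have [hA|hA] := leqP q #|A|.
  exists A, (tperm b); split=> // [j|j k].
    by rewrite inE => /andP[jZ _]; apply: fixx.
  rewrite !inE => /andP[_ /eqP yj] /andP[_ /eqP yk] /ffunP /(_ j).
  rewrite !ffunE tpermR; case: tpermP => // [jb|_ _ e].
    by move: yb; rewrite -jb yj eqxx.
  by move: yb; rewrite e yj eqxx.
exists (Z :\: A), (tperm a); split=> [|j|j k].
- have := cardsID A Z; rewrite (setIidPr _) ?subsetIl //; lia.
- by rewrite inE => /andP[_ jZ]; apply: fixx.
rewrite !inE => /andP[hj jZ] /andP[hk kZ] /ffunP /(_ j).
rewrite !ffunE tpermR; case: tpermP => // [ja|_ _ e].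
  by move: hj; rewrite jZ ja ya eqxx.
by move: hj; rewrite jZ -e ya eqxx.
Qed.

Definition level n (x : cube3 n) (v : 'I_3) := [set j | x j == v].

(* Points with few twos are not excluded: moves among zeros or ones suffice. *)
Definition typical n q : {set cube3 n} :=
  [set x | (2 * q <= #|level x ord0|) && (2 * q <= #|level x (inord 1)|)].

(** If [y] is nonzero at some zero of [x], take [Z] to be the zeros of [x]: it also contains the
    zeros of [y]. Otherwise both vanish at the same positions, so where they differ [x] is 1 and [y]
    is 2. Then take [Z] to be the ones of [x], which contain the ones of [y]. *)
Lemma comparable_moves n q (x y : cube3 n) : 0 < q ->
  x \in typical n q -> y \in typical n q -> cle x y -> x != y ->
  exists (J : {set 'I_n}) (s : 'I_n -> 'S_n),
    [/\ q <= #|J|, forall j, j \in J -> permute x (s j) = x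
      & {in J &, injective (fun j => permute y (s j))}].
Proof.
move=> q0; rewrite !inE => /andP[x0 x1] /andP[y0 y1] /forallP le ne.
have cst v : {in level x v &, forall i j, x i = x j}.
  by move=> i j; rewrite !inE => /eqP -> /eqP ->.
have v1 : (inord 1 : 'I_3) = 1 :> nat by rewrite inordK.
have /card_gt0P[a] : 0 < #|level y ord0| by lia.
rewrite inE => /eqP ya.
have [/existsP[b /andP[bx0 yb]]|] :=
  boolP [exists b, (x b == ord0) && (y b != ord0)].
  apply: (stabilizer_moves (cst ord0) _ _ ya yb x0); rewrite !inE //.
  by rewrite -val_eqE /= -leqn0; have := le a; rewrite ya.
rewrite negb_exists => /forallP no.
have xy0 i : y i != ord0 -> x i != ord0.
  by have := no i; rewrite negb_and negbK; case: eqP => //= _ ->.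
have /card_gt0P[c] : 0 < #|level y (inord 1)| by lia.
rewrite inE => /eqP yc.
have [b xyb] : exists b, x b != y b.
  apply/existsP; apply: contraR ne; rewrite negb_exists => /forallP h.
  by apply/eqP/ffunP => j; apply/eqP; have := h j; rewrite negbK.
have tri i : 0 < y i -> 0 < x i <= y i.
  move=> yi; rewrite le andbT lt0n; apply: (xy0 i).
  by rewrite -val_eqE /= -lt0n.
have b1 : x b = inord 1 /\ y b != inord 1.
  have lb := le b; have := tri b; have := ltn_ord (y b); move: xyb.
  rewrite -!val_eqE /= v1 => nb l3 tb; have yb : nat_of_ord (y b) = 2 by lia.
  by split; [apply/val_inj; rewrite /= v1; lia | rewrite yb].
apply: (stabilizer_moves (cst (inord 1)) _ _ yc b1.2 x1); rewrite inE ?b1.1 //.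
by rewrite -val_eqE /= v1; have := tri c; rewrite yc v1; lia.
Qed.

Lemma chain_map_inj n (phi : cube3 n -> cube3 n) x y : chain_map phi ->
  phi x = phi y -> rank x = rank y -> x = y.
Proof.
by move=> [_ ch] /ch /orP[] h e; [|symmetry]; apply: cle_antirank.
Qed.

Lemma card_cube3 n : #|{: cube3 n}| = 3 ^ n.
Proof. by rewrite card_ffun !card_ord. Qed.

Lemma ell_card n : ell n n = #|[set x : cube3 n | rank x == n]|.
Proof. by []. Qed.

Lemma rank_le n (x : cube3 n) : rank x <= 2 * n.
Proof.
apply: (@leq_trans (\sum_(j < n) 2)); last by rewrite sum_nat_const card_ord mulnC.
by apply: leq_sum => j _; rewrite -ltnS.
Qed.

(** A point is determined by its chain and its rank, and there are [2n + 1] ranks. *)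
Lemma cube3_le_ell n : 3 ^ n <= (2 * n).+1 * ell n n.
Proof.
have [phi cphi] := chain_map_exists n.
rewrite -card_cube3 ell_card.
pose f (x : cube3 n) : 'I_(2 * n).+1 * cube3 n := (inord (rank x), phi x).
have fi : injective f.
  move=> x y [/(congr1 val)]; rewrite /= !inordK ?ltnS ?rank_le // => e1 e2.
  exact: chain_map_inj cphi e2 e1.
rewrite -cardsT -(card_imset _ fi).
apply: (@leq_trans #|setX [set: 'I_(2 * n).+1] [set x : cube3 n | rank x == n]|).
  apply: subset_leq_card; apply/subsetP => _ /imsetP[x _ ->].
  by rewrite !inE /= cphi.1 eqxx.
by rewrite cardsX cardsT card_ord.
Qed.

(** This is [n!] times the probability that a random coordinate permutation puts [x] and [y] on one
    chain. *)
Definition coincidences n (phi : cube3 n -> cube3 n) x y :=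
  #|[set s : 'S_n | phi (permute x s) == phi (permute y s)]|.

Lemma coincidencesE n (phi : cube3 n -> cube3 n) x y :
  coincidences phi x y =
  \sum_(s : 'S_n) (phi (permute x s) == phi (permute y s)).
Proof.
by rewrite /coincidences -sum1dep_card big_mkcond; apply: eq_bigr => s _; case: (_ == _).
Qed.

Lemma coincidences_sym n (phi : cube3 n -> cube3 n) x y :
  coincidences phi x y = coincidences phi y x.
Proof. by rewrite /coincidences; apply: eq_card => s; rewrite !inE eq_sym. Qed.

(* Precomposing with moves that fix [x] and send [y] to distinct points of the
   same rank cannot keep both ends in one chain more than once. *)
Lemma coincidences_le n q (phi : cube3 n -> cube3 n) x y : chain_map phi ->
  0 < q -> x \in typical n q -> y \in typical n q ->
  cle x y -> x != y -> q * coincidences phi x y <= n`!.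
Proof.
move=> cphi q0 tx ty le ne.
have [J [s [hJ sx sy]]] := comparable_moves q0 tx ty le ne.
apply: (@leq_trans (#|J| * coincidences phi x y)); first by rewrite leq_mul2r hJ orbT.
rewrite -sum_nat_const.
have -> : \sum_(j in J) coincidences phi x y =
  \sum_(j in J) \sum_(t : 'S_n) (phi (permute x t) == phi (permute (permute y (s j)) t)).
  (* The sum over all permutations is invariant under right translation, which by [permuteM] lets
     [s j] act first; it fixes [x]. *)
  apply: eq_bigr => j jJ; rewrite coincidencesE (reindex_inj (mulIg (s j))).
  by apply: eq_bigr => t _; rewrite !permuteM sx.
rewrite exchange_big /= -card_Sn -sum1_card; apply: leq_sum => t _.
rewrite -big_mkcondr sum1_card; apply/card_le1_eqP => j k.
rewrite !unfold_in /= => /andP[jJ /eqP ej] /andP[kJ /eqP ek].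
apply: sy => //; apply: (@permute_inj _ t).
by apply: (chain_map_inj cphi); rewrite ?rank_permute // -ej.
Qed.

Lemma coincidences_incomparable n (phi : cube3 n -> cube3 n) x y :
  chain_map phi -> ~~ (cle x y || cle y x) -> coincidences phi x y = 0.
Proof.
move=> [_ ch] inc; apply: eq_card0 => s; rewrite !inE.
by apply: contraNF inc => /eqP/ch; rewrite !cle_permute.
Qed.

Lemma coincidences_refl n (phi : cube3 n -> cube3 n) x : coincidences phi x x = n`!.
Proof. by rewrite -card_Sn; apply: eq_card => s; rewrite !inE eqxx. Qed.

(** Cauchy-Schwarz, by summing [2ab <= a^2 + b^2] over all pairs. *)
Lemma sqr_sum_le (I : finType) (L : {set I}) (c : I -> nat) :
  (\sum_(i in L) c i) ^ 2 <= #|L| * \sum_(i in L) c i ^ 2.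
Proof.
rewrite -(leq_pmul2l (isT : 0 < 2)) expnS expn1 big_distrlr big_distrr /=.
apply: (@leq_trans (\sum_(i in L) \sum_(j in L) (c i ^ 2 + c j ^ 2))).
  apply: leq_sum => i _; rewrite big_distrr /=; apply: leq_sum => j _.
  exact: nat_Cauchy.
under eq_bigr do rewrite big_split /= sum_nat_const.
by rewrite big_split /= sum_nat_const -big_distrr /= addnn -mul2n.
Qed.

(** Cauchy-Schwarz applied to the fibre sizes of [f] on [F]; the double sum includes the
    diagonal. *)
Lemma collisions_ge (I J : finType) (F : {set I}) (L : {set J}) (f : I -> J) :
  (forall x, f x \in L) ->
  #|F| ^ 2 <= #|L| * \sum_(x in F) \sum_(y in F) (f x == f y).
Proof.
move=> fL; have part : #|F| = \sum_(l in L) \sum_(x in F) (f x == l).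
  rewrite exchange_big /= -sum1_card; apply: eq_bigr => x _.
  rewrite (bigD1 (f x)) //= eqxx big1 // => l /andP[_ h].
  by rewrite eq_sym (negbTE h).
rewrite {1}part; apply: leq_trans (sqr_sum_le _ _) _; rewrite leq_mul2l.
apply/orP; right; apply: eq_leq.
rewrite (eq_bigr (fun l => \sum_(x in F) \sum_(y in F) (f x == l) * (f y == l))); last first.
  by move=> l _; rewrite expnS expn1 big_distrlr.
rewrite exchange_big; apply: eq_bigr => x _; rewrite exchange_big.
apply: eq_bigr => y _; rewrite (bigD1 (f x)) //= eqxx mul1n big1 ?addn0 1?eq_sym //.
by move=> l /andP[_ h]; rewrite eq_sym (negbTE h).
Qed.

Definition nbrs n (x : cube3 n) : {set cube3 n} :=
  [set y | (x != y) && (cle x y || cle y x)].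

(** Double counting of triples of two points of [F] and a permutation placing them on one chain.
    Every permutation yields at least [|F|^2 / ell] pairs. An equal pair is counted [n!] times, a
    comparable pair at most [n!/q] times, an incomparable pair never. Some [x] does at least as well
    as the average. *)
Lemma supersaturation n q (F : {set cube3 n}) : 0 < q -> F \subset typical n q ->
  F != set0 ->
  exists2 x, x \in F & q * #|F| <= ell n n * (q + #|F :&: nbrs x|).
Proof.
move=> q0 /subsetP FT F0; have [phi cphi] := chain_map_exists n.
have step1 : n`! * #|F| ^ 2 <=
    ell n n * \sum_(x in F) \sum_(y in F) coincidences phi x y.
  rewrite -card_Sn -sum_nat_const.
  have -> : \sum_(x in F) \sum_(y in F) coincidences phi x y =
    \sum_(s : 'S_n) \sum_(x in F) \sum_(y in F)
      (phi (permute x s) == phi (permute y s)).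
    rewrite [RHS]exchange_big /=; apply: eq_bigr => x _; rewrite [RHS]exchange_big /=.
    by apply: eq_bigr => y _; rewrite coincidencesE.
  rewrite big_distrr /=; apply: leq_sum => s _; rewrite ell_card.
  by apply: (@collisions_ge _ _ F _ (fun x => phi (permute x s))) => x; rewrite inE cphi.1.
have step2 x : x \in F ->
    q * \sum_(y in F) coincidences phi x y <= n`! * (q + #|F :&: nbrs x|).
  move=> xF; rewrite (bigD1 x) //= coincidences_refl !mulnDr mulnC leq_add2l.
  rewrite big_distrr mulnC -sum_nat_const /= (bigID (mem (nbrs x))) /=.
  rewrite [X in _ + X]big1 ?addn0; last first.
    move=> y /andP[/andP[yF ne]]; rewrite inE eq_sym ne /= => h.
    by rewrite coincidences_incomparable // muln0.
  rewrite [X in X <= _](eq_bigl (mem (F :&: nbrs x))); last first.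
    by move=> y; rewrite /= !inE; case: eqVneq; rewrite ?andbF ?andbT // => ->; rewrite ?andbF.
  apply: leq_sum => y; rewrite !inE => /and3P[yF ne /orP[] h].
    by apply: coincidences_le => //; apply: FT.
  by rewrite coincidences_sym coincidences_le ?FT // eq_sym.
have step3 : q * #|F| ^ 2 <= ell n n * \sum_(x in F) (q + #|F :&: nbrs x|).
  rewrite -(leq_pmul2l (fact_gt0 n)) mulnCA.
  apply: (@leq_trans (q * (ell n n * \sum_(x in F) \sum_(y in F) coincidences phi x y))).
    by rewrite leq_mul2l step1 orbT.
  rewrite mulnCA [X in _ <= X]mulnCA leq_mul2l; apply/orP; right.
  by rewrite !big_distrr; apply: leq_sum.
have [/existsP[x /andP[xF h]]|] :=
  boolP [exists x, (x \in F) && (q * #|F| <= ell n n * (q + #|F :&: nbrs x|))].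
  by exists x.
rewrite negb_exists => /forallP no; move: step3; rewrite leqNgt => /negP[].
(* If every member of [F] fell short, summing the strict inequalities would contradict [step3]; [z]
   supplies one strict term. *)
rewrite expnS expn1 mulnCA -sum_nat_const big_distrr /=.
have [z zF] := set0Pn _ F0.
have lt x : x \in F -> ell n n * (q + #|F :&: nbrs x|) < q * #|F|.
  by move=> xF; have := no x; rewrite xF ltnNge.
rewrite (bigD1 z) //= [X in _ < X](bigD1 z) //= -addSn leq_add ?lt //.
by apply: leq_sum => x /andP[xF _]; apply/ltnW/lt.
Qed.

(** * Counting antichains *)

Lemma antichainP n (S : {set cube3 n}) :
  reflect {in S &, forall x y, x != y -> ~~ cle x y} (antichain S).
Proof.
apply: (iffP forall_inP) => [h x y xS yS ne|h x xS].
  by move/forall_inP: (h x xS) => /(_ y yS) /implyP; apply.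
by apply/forall_inP => y yS; apply/implyP; apply: h.
Qed.

Lemma antichainS n (S S' : {set cube3 n}) :
  S \subset S' -> antichain S' -> antichain S.
Proof.
by move=> /subsetP sub /antichainP h; apply/antichainP => x y /sub xS /sub; apply: h.
Qed.

Definition antichains_in n (F : {set cube3 n}) :=
  #|[set S : {set cube3 n} | (S \subset F) && antichain S]|.

Lemma antichains_in0 n : antichains_in (@set0 (cube3 n)) <= 1.
Proof.
apply: (@leq_trans #|[set (@set0 (cube3 n))]|); last by rewrite cards1.
apply: subset_leq_card.
by apply/subsetP => S; rewrite !inE subset0 => /andP[].
Qed.

Lemma antichains_in_rec n (F : {set cube3 n}) v : v \in F ->
  antichains_in F <= antichains_in (F :\ v) + antichains_in ((F :\ v) :\: nbrs v).
Proof.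
move=> vF; rewrite {1}/antichains_in -(cardsID [set S : {set cube3 n} | v \notin S]).
apply: leq_add.
  apply: subset_leq_card; apply/subsetP => S; rewrite !inE.
  by case/andP=> /andP[sF ->] vS; rewrite andbT subsetD1 sF.
set X := _ :\: _; have inj : {in X &, injective (fun S : {set cube3 n} => S :\ v)}.
  move=> S S'; rewrite !inE !negbK => /andP[vS _] /andP[vS' _] e.
  by rewrite -(setD1K vS) -(setD1K vS') e.
rewrite -(card_in_imset inj); apply: subset_leq_card; apply/subsetP => _ /imsetP[S + ->].
rewrite !inE negbK => /andP[vS /andP[/subsetP sF aS]].
rewrite (antichainS (subD1set _ _) aS) andbT.
apply/subsetP => y; rewrite !inE => /andP[yv yS]; rewrite yv (sF _ yS) !andbT /=.
move/antichainP: aS => aS.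
by rewrite negb_and negb_or !aS ?orbT // eq_sym.
Qed.

(** An antichain is determined by its traces on [T] and on the complement; the latter trace is
    bounded trivially, since the complement will be small. *)
Lemma num_antichains_split n (T : {set cube3 n}) :
  num_antichains n <= 2 ^ #|~: T| * antichains_in T.
Proof.
rewrite -card_powerset -cardsX.
have inj : injective (fun S : {set cube3 n} => (S :&: ~: T, S :&: T)).
  by move=> S S' [e1 e2]; rewrite -(setID S T) -(setID S' T) !setDE e1 e2.
rewrite /num_antichains -(card_imset _ inj); apply: subset_leq_card.
apply/subsetP => _ /imsetP[S aS ->]; rewrite !inE /= !subsetIr /=.
by move: aS; rewrite inE; apply: antichainS; apply: subsetIl.
Qed.

Lemma num_antichains_ge n : 2 ^ ell n n <= num_antichains n.
Proof.
rewrite ell_card -card_powerset; apply: subset_leq_card; apply/subsetP => S.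
rewrite !inE => /subsetP sL; apply/antichainP => x y /sL + /sL.
rewrite !inE => /eqP rx /eqP ry; apply: contra => le.
by apply/eqP/cle_antirank; rewrite // rx ry.
Qed.

(* Chernoff's method: weight [x] by [2 ^ #{j | x j != v}]. *)
Lemma few_at_level n q (v : 'I_3) : 2 * q <= n ->
  #|[set x : cube3 n | #|level x v| < 2 * q]| * 2 ^ (n - 2 * q) <= 5 ^ n.
Proof.
move=> hq; have -> : 5 ^ n = \sum_(x : cube3 n) 2 ^ (n - #|level x v|).
  (* The total weight factors over coordinates, each contributing [1 + 2 + 2]. *)
  have <- : \prod_(j < n) \sum_(i < 3) (if i == v then 1 else 2) = 5 ^ n.
    rewrite prod_nat_const card_ord (bigD1 v) //= eqxx.
    rewrite (eq_bigr (fun=> 2)) => [|i /negbTE -> //].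
    by rewrite sum_nat_const cardC1 card_ord.
  rewrite bigA_distr_bigA; apply: eq_bigr => x _.
  rewrite (bigID [pred j | x j == v]) /= big1 => [|j -> //].
  rewrite mul1n (eq_bigr (fun=> 2)) => [|j /negbTE -> //].
  rewrite prod_nat_const; congr (_ ^ _).
  have := cardC (mem (level x v)); rewrite card_ord => /(canRL (addKn _)) <-.
  by apply: eq_card => j; rewrite !inE.
rewrite -sum_nat_const [X in _ <= X](bigID (fun x : cube3 n => x \in [set x : cube3 n | #|level x v| < 2 * q])) /=.
apply: leq_trans (leq_addr _ _); apply: leq_sum => x; rewrite inE => /ltnW h.
by rewrite leq_exp2l // leq_sub2l.
Qed.

Lemma atypical_le n q : 2 * q <= n ->
  #|~: typical n q| * 2 ^ (n - 2 * q) <= 2 * 5 ^ n.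
Proof.
move=> hq; have h0 := few_at_level ord0 hq; have h1 := few_at_level (inord 1) hq.
rewrite [2 * 5 ^ n]mul2n -addnn; apply: leq_trans (leq_add h0 h1); rewrite -mulnDl leq_mul2r.
apply/orP; right; set B0 := [set x | _]; set B1 := [set x | _].
apply: (@leq_trans #|B0 :|: B1|); last by rewrite cardsU leq_subr.
by apply: subset_leq_card; apply/subsetP => x; rewrite !inE negb_and -!ltnNge.
Qed.

(** * Estimates *)

Open Scope R_scope.

Lemma leq_INR (m n : nat) : (m <= n)%nat -> INR m <= INR n.
Proof. by move/leP/le_INR. Qed.

Lemma INR_addn (m n : nat) : INR (m + n)%nat = INR m + INR n.
Proof. exact: plus_INR. Qed.

Lemma INR_muln (m n : nat) : INR (m * n)%nat = INR m * INR n.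
Proof. exact: mult_INR. Qed.

Lemma INR_expn (m n : nat) : INR (expn m n) = INR m ^ n.
Proof. by elim: n => [|n IH]; rewrite ?expn0 // expnS INR_muln IH. Qed.

Lemma ln_ge_inv x : 0 < x -> 1 - / x <= ln x.
Proof.
move=> x0; have ix := Rinv_0_lt_compat _ x0; have := ln_Rinv _ x0.
have := exp_ineq1_le (ln (/ x)); rewrite exp_ln //; lra.
Qed.

Lemma ln_le_sub1 x : 0 < x -> ln x <= x - 1.
Proof. by move=> x0; have := exp_ineq1_le (ln x); rewrite exp_ln //; lra. Qed.

Lemma ln_mono x y : 0 < x -> x <= y -> ln x <= ln y.
Proof.
move=> x0 [h|->]; last exact: Rle_refl.
by left; apply: ln_increasing.
Qed.

Lemma ln_pow_INR x k : 0 < x -> ln (x ^ k) = INR k * ln x.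
Proof. by move=> x0; apply: ln_pow. Qed.

(** * Solving the recursion for antichains *)

Fixpoint growth (b : nat -> R) (m : nat) : R :=
  if m is k.+1 then growth b k * (1 + b m) else 1.

Lemma growth_gt0 b m : (forall i, 0 <= b i) -> 0 < growth b m.
Proof.
move=> b0; elim: m => [|m IH] /=; first lra.
by apply: Rmult_lt_0_compat => //; have := b0 m.+1; lra.
Qed.

Lemma growth_mono b (m k : nat) : (forall i, 0 <= b i) ->
  growth b m <= growth b (m + k)%nat.
Proof.
move=> b0; elim: k => [|k IH]; first by rewrite addn0; lra.
rewrite addnS /=; have := b0 (m + k).+1; have := growth_gt0 (m + k)%nat b0; nra.
Qed.

Lemma growth_ratio b (m k : nat) c : (forall i, 0 <= b i) -> 0 <= c ->
  (forall i, (i <= m + k)%nat -> c <= b i) ->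
  growth b m * (1 + c) ^ k <= growth b (m + k)%nat.
Proof.
move=> b0 c0; elim: k => [|k IH] cb; first by rewrite addn0 /=; lra.
rewrite addnS /= -addnS; have {}IH : growth b m * (1 + c) ^ k <= growth b (m + k)%nat.
  by apply: IH => i hi; apply: cb; lia.
have := cb (m + k.+1)%nat (leqnn _); have := growth_gt0 (m + k)%nat b0.
have : 0 < growth b m * (1 + c) ^ k.
  by apply: Rmult_lt_0_compat; [apply: growth_gt0 | apply: pow_lt; lra].
move: IH; set X := growth b m; set Y := growth b (m + k)%nat; set Z := (1 + c) ^ k.
nra.
Qed.

(** Strong induction on [m = |F|]. Let [Y] and [X] be the bounds for [m - 1] and [m - 1 - D] points.
    As [b] decreases, [X (1 + b_m)^D <= Y]; with [1 <= b_m (1 + b_m)^D] this gives [X <= b_m Y], so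
    the recursion gives at most [Y + X <= Y (1 + b_m)]. *)
Lemma antichains_in_growth n q b (F : {set cube3 n}) :
  (0 < q)%nat -> F \subset typical n q ->
  (forall i, 0 <= b i) -> (forall i j, (i <= j)%nat -> b j <= b i) ->
  (forall m D : nat, (0 < m <= expn 3 n)%nat -> (q * m <= ell n n * (q + D))%nat ->
    1 <= b m * (1 + b m) ^ D) ->
  INR (antichains_in F) <= growth b #|F|.
Proof.
move=> q0 + b0 bdec bD.
have [k hk] := ubnP #|F|; elim: k F hk => // k IH F; rewrite ltnS => hk FT.
have [->|F0] := eqVneq F set0.
  by rewrite cards0; apply: (leq_INR (antichains_in0 n)).
have [v vF deg] := supersaturation q0 FT F0.
have cF : #|F| = #|F :\ v|.+1 by rewrite (cardsD1 v) vF.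
set D := #|F :&: nbrs v| in deg.
have cD : #|F :\ v| = (#|(F :\ v) :\: nbrs v| + D)%nat.
  rewrite -(cardsID (nbrs v) (F :\ v)) addnC; congr (_ + _)%nat; apply: eq_card => y.
  by rewrite !inE [v == y]eq_sym; case: (y != v); rewrite ?andbF.
have := bD #|F| D; rewrite {1}cF deg -card_cube3 max_card => /(_ isT isT) step.
have := leq_INR (antichains_in_rec vF); rewrite INR_addn.
have := IH (F :\ v); rewrite -cF => /(_ hk) => h1.
have {}h1 := h1 (subset_trans (subD1set _ _) FT).
have := IH ((F :\ v) :\: nbrs v).
have -> : (#|(F :\ v) :\: nbrs v| < k)%nat by lia.
move=> /(_ isT (subset_trans (subsetDl _ _) (subset_trans (subD1set _ _) FT))) h2.
have ratio : growth b #|(F :\ v) :\: nbrs v| * (1 + b #|F|) ^ D <= growth b #|F :\ v|.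
  by rewrite [in X in _ <= X]cD; apply: growth_ratio => // i hi; apply: bdec; lia.
rewrite [in X in _ -> _ <= X]cF /= -cF.
have := growth_gt0 #|(F :\ v) :\: nbrs v| b0; have := b0 #|F|.
move: h1 h2 ratio step.
set Y := growth b _; set X := growth b _; set Z := (1 + b _) ^ _; set c := b _.
move=> h1 h2 ratio step c0 X0 h3.
have : X * 1 <= X * (c * Z) by apply: Rmult_le_compat_l; lra.
have : c * (X * Z) <= c * Y by apply: Rmult_le_compat_l.
lra.
Qed.

Lemma ln_le_cancel x y : 0 < x -> 0 < y -> ln x <= ln y -> x <= y.
Proof.
move=> x0 y0 h; case: (Rle_lt_dec x y) => // lt.
by have := ln_increasing _ _ y0 lt; lra.
Qed.

(** With [L = ell], supersaturation forces degree at least [q (m - L) / L], so beyond the cutoff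
    rate times degree is at least [q A / L]. A cutoff [m0 >= L + A] keeps the rate at most 1 and
    decreasing. *)
Definition rate (L A : R) (m0 m : nat) : R :=
  if (m <= m0)%nat then 1 else A / (INR m - L).

Lemma rate_gap L A (m0 m : nat) : L + A <= INR m0 -> (m0 < m)%nat ->
  A + 1 <= INR m - L.
Proof. by move=> h /leq_INR; rewrite S_INR; lra. Qed.

Lemma rate_bounds L A m0 m : 0 < A -> L + A <= INR m0 ->
  0 < rate L A m0 m <= 1.
Proof.
move=> A0 h; rewrite /rate; case: leqP => [_|hm]; first lra.
have g := rate_gap h hm; split; first by apply: Rdiv_lt_0_compat; lra.
by apply: (Rmult_le_reg_r (INR m - L)); rewrite /Rdiv ?Rmult_assoc ?Rinv_l; lra.
Qed.

Lemma rate_decr L A m0 (i j : nat) : 0 < A -> L + A <= INR m0 -> (i <= j)%nat ->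
  rate L A m0 j <= rate L A m0 i.
Proof.
move=> A0 h hij; rewrite {2}/rate; case: leqP => [_|hi].
  by have := rate_bounds j A0 h; lra.
rewrite /rate leqNgt (leq_trans hi hij) /=; apply: Rmult_le_compat_l; first lra.
by apply: Rinv_le_contravar; have := rate_gap h hi; have := leq_INR hij; lra.
Qed.

Lemma growth_rate_init L A (m0 m : nat) : (m <= m0)%nat ->
  growth (rate L A m0) m = 2 ^ m.
Proof.
elim: m => //= m IH hm; rewrite IH ?(ltnW hm) // /rate hm.
by rewrite Rmult_comm.
Qed.

(* Telescopes [1 / s <= ln s - ln (s - 1)]. *)
Lemma ln_growth_rate L A (m0 k : nat) : 0 < A -> L + A <= INR m0 ->
  ln (growth (rate L A m0) (m0 + k)%nat) <=
    INR m0 * ln 2 + A * (ln (INR (m0 + k)%nat - L) - ln A).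
Proof.
move=> A0 h; have b0 i : 0 <= rate L A m0 i by have := rate_bounds i A0 h; lra.
elim: k => [|k IH].
  rewrite addn0 growth_rate_init // ln_pow_INR; last lra.
  have : ln A <= ln (INR m0 - L) by apply: ln_mono; lra.
  by move=> ?; have := Rmult_le_compat_l A 0 (ln (INR m0 - L) - ln A); lra.
rewrite addnS [growth _ _.+1]/=.
have G0 := growth_gt0 (m0 + k)%nat b0; have r := rate_bounds (m0 + k).+1 A0 h.
rewrite ln_mult //; last lra.
have gap : A <= INR (m0 + k)%nat - L.
  by have := leq_INR (leq_addr k m0); lra.
have e1 : ln (1 + rate L A m0 (m0 + k).+1) <= A / (INR (m0 + k).+1 - L).
  apply: Rle_trans (ln_le_sub1 _) _; first lra.
  by rewrite /rate ltnNge leq_addr /=; lra.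
have e2 : / (INR (m0 + k).+1 - L) <=
    ln (INR (m0 + k).+1 - L) - ln (INR (m0 + k)%nat - L).
  rewrite S_INR; set s := INR (m0 + k)%nat - L in gap *.
  have -> : INR (m0 + k)%nat + 1 - L = s + 1 by rewrite /s; lra.
  have s0 := Rinv_0_lt_compat s ltac:(lra).
  have := @ln_ge_inv ((s + 1) * / s); rewrite ln_mult ?ln_Rinv; try lra.
  have -> : / ((s + 1) * / s) = 1 - / (s + 1) by field; lra.
  by move=> e; have := e ltac:(nra); lra.
have := Rmult_le_compat_l A _ _ _ e2; rewrite /Rdiv in e1; lra.
Qed.

(** Past the cutoff, [r D >= q A / L = 6 ln n] and [ln (1 + r) >= r / 2] give [(1 + r)^D >= n^3].
    Since [m <= (2n + 1) L], also [r >= 6 / (n (2n + 1))], which [n^3] outweighs. *)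
Lemma rate_step (n q m D m0 : nat) (L A : R) :
  (16 <= n)%nat -> (0 < q <= n)%nat -> 0 < L -> 1 <= ln (INR n) ->
  A = 6 * L * ln (INR n) / INR q -> L + A <= INR m0 ->
  INR m <= (2 * INR n + 1) * L -> INR q * INR m <= L * (INR q + INR D) ->
  1 <= rate L A m0 m * (1 + rate L A m0 m) ^ D.
Proof.
move=> n16 /andP[q0 qn] L0 ln1 eA hm0 mM deg.
have {}n16 : 16 <= INR n by have := leq_INR n16; rewrite [INR 16]/=; lra.
have {}q0 : 1 <= INR q by apply: (leq_INR q0).
have {}qn := leq_INR qn.
have A0 : 0 < A by rewrite eA; apply: Rdiv_lt_0_compat; nra.
have r := rate_bounds m A0 hm0; move: r; rewrite /rate; case: leqP => hm [r0 r1].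
  by rewrite Rmult_1_l; apply: pow_R1_Rle; lra.
have s0 := rate_gap hm0 hm; set s := INR m - L in r0 r1 s0 *.
set r := A / s in r0 r1 *.
have Lsq : INR q * s <= L * INR D by rewrite /s; nra.
have qA : INR q * A = 6 * L * ln (INR n) by rewrite eA; field; lra.
have rs : r * s = A by rewrite /r; field; lra.
have rD : 6 * ln (INR n) <= r * INR D.
  have : r * (INR q * s) <= r * (L * INR D) by apply: Rmult_le_compat_l; lra.
  have -> : r * (INR q * s) = INR q * A by rewrite -rs; ring.
  by rewrite qA => ?; apply: (Rmult_le_reg_l L); lra.
have lnr : r / 2 <= ln (1 + r).
  apply: Rle_trans (ln_ge_inv _); last lra.
  have : / (1 + r) * (1 + r) = 1 by field; lra.
  by have := Rinv_0_lt_compat (1 + r); nra.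
have big : INR n ^ 3 <= (1 + r) ^ D.
  apply: ln_le_cancel; try (by apply: pow_lt; lra).
  rewrite !ln_pow_INR; try lra.
  have := pos_INR D; rewrite [INR 3]/=; nra.
have rlow : 6 <= r * (INR n * (2 * INR n + 1)).
  have : A <= r * ((2 * INR n + 1) * L).
    by rewrite -rs; apply: Rmult_le_compat_l; rewrite /s; lra.
  move=> h; apply: (Rmult_le_reg_l L) => //.
  have : INR q * A <= INR q * (r * ((2 * INR n + 1) * L)) by apply: Rmult_le_compat_l; lra.
  rewrite qA => h2; have : INR q * (r * ((2 * INR n + 1) * L)) <= INR n * (r * ((2 * INR n + 1) * L)).
    by apply: Rmult_le_compat_r => //; nra.
  have : 6 * L * 1 <= 6 * L * ln (INR n) by apply: Rmult_le_compat_l; lra.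
  lra.
have : r * INR n ^ 3 <= r * (1 + r) ^ D by apply: Rmult_le_compat_l; lra.
have : r * (INR n * (2 * INR n + 1)) <= r * INR n ^ 3.
  by apply: Rmult_le_compat_l; [lra | rewrite /=; nra].
lra.
Qed.

(** * Size of the middle level and of the atypical set *)

Lemma cube3_le_ell_INR n : 3 ^ n <= (2 * INR n + 1) * INR (ell n n).
Proof.
have := leq_INR (cube3_le_ell n); rewrite INR_expn INR_muln [INR 3]/= S_INR INR_muln [INR 2]/=.
by have -> : 1 + 1 + 1 = 3 by lra.
Qed.

Lemma ell_gt0 n : 0 < INR (ell n n).
Proof.
have := cube3_le_ell_INR n; have := pow_lt 3 n; have := pos_INR n.
have := pos_INR (ell n n) => -[] // <- ?; lra.
Qed.

Lemma sixteenth_bounds n : (16 <= n)%nat ->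
  [/\ (0 < n %/ 16)%nat, INR n <= 32 * INR (n %/ 16) & 16 * INR (n %/ 16) <= INR n].
Proof.
move=> hn; have h1 : (16 * (n %/ 16) <= n)%nat by lia.
have h2 : (n <= 32 * (n %/ 16))%nat by lia.
have := leq_INR h1; have := leq_INR h2; rewrite !INR_muln ![INR 16]/= ![INR 32]/=.
by split; [lia | lra | lra].
Qed.

(** Of the [n] factors [6/5], [8q] absorb [4^q] because [4 * 5^8 <= 6^8]. Two blocks of [4q] each
    gain [n/40] by Bernoulli's inequality, whence [1600 = 40^2]. *)
Lemma exponential_gap n : (16 <= n)%nat ->
  INR n ^ 2 * (5 ^ n * 4 ^ (n %/ 16)) <= 1600 * 6 ^ n.
Proof.
move=> hn; have [q0 hq _] := sixteenth_bounds hn; set q := (n %/ 16)%nat in q0 hq *.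
have en : n = (8 * q + (4 * q + 4 * q) + (n - 16 * q))%nat by lia.
have [e5 e6] : 5 ^ n = (5 ^ 8) ^ q * (5 ^ (4 * q)%nat * 5 ^ (4 * q)%nat) * 5 ^ (n - 16 * q)%nat /\
   6 ^ n = (6 ^ 8) ^ q * (6 ^ (4 * q)%nat * 6 ^ (4 * q)%nat) * 6 ^ (n - 16 * q)%nat.
  by rewrite -!pow_mult -!pow_add; split; congr (_ ^ _); exact: en.
have p5 k : 0 < 5 ^ k by apply: pow_lt; lra.
have h1 : (5 ^ 8) ^ q * 4 ^ q <= (6 ^ 8) ^ q.
  by rewrite -Rpow_mult_distr; apply: pow_incr; lra.
have h2 : INR n / 40 * 5 ^ (4 * q)%nat <= 6 ^ (4 * q)%nat.
  have := poly (4 * q) (/ 5) ltac:(lra); rewrite INR_muln [INR 4]/= => h.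
  have -> : 6 = 5 * (1 + / 5) by lra.
  rewrite Rpow_mult_distr Rmult_comm; apply: Rmult_le_compat_l; first exact: Rlt_le.
  lra.
have h3 : 5 ^ (n - 16 * q)%nat <= 6 ^ (n - 16 * q)%nat by apply: pow_incr; lra.
have n0 := pos_INR n.
rewrite e5 e6; move: h1 h2 h3 (p5 (4 * q)%nat) (p5 (n - 16 * q)%nat).
have : 0 < (5 ^ 8) ^ q * 4 ^ q by apply: Rmult_lt_0_compat; apply: pow_lt; lra.
set a := (5 ^ 8) ^ q; set a' := (6 ^ 8) ^ q; set c := 5 ^ _; set c' := 6 ^ _.
set d := 5 ^ _; set d' := 6 ^ _; set f := 4 ^ q => ha h1 h2 h3 c0 d0.
have -> : INR n ^ 2 * (a * (c * c) * d * f) =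
  1600 * (a * f * ((INR n / 40 * c) * (INR n / 40 * c)) * d) by field.
have t0 : 0 <= INR n / 40 * c by apply: Rmult_le_pos; lra.
apply: Rmult_le_compat_l; first lra.
apply: Rmult_le_compat => //; try lra.
  by apply: Rmult_le_pos; [lra | apply: Rmult_le_pos].
by apply: Rmult_le_compat => //; [lra | apply: Rmult_le_pos | apply: Rmult_le_compat].
Qed.

(** The Chernoff bound and [exponential_gap] give [B n^2 <= 3200 * 3^n] for the number [B] of
    atypical points; then [3^n <= (2n + 1) ell <= 3 n ell]. *)
Lemma atypical_small n : (16 <= n)%nat ->
  INR #|~: typical n (n %/ 16)| * INR n <= 9600 * INR (ell n n).
Proof.
move=> hn; have gap := exponential_gap hn; set q := (n %/ 16)%nat in gap *.
have hq : (2 * q <= n)%nat by rewrite /q; lia.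
have := leq_INR (atypical_le hq); rewrite INR_muln; set B := INR #|_|.
rewrite !INR_muln !INR_expn [INR 2]/= [INR 5]/=.
have -> : 1 + 1 + 1 + 1 + 1 = 5 by lra. have -> : 1 + 1 = 2 by lra.
move=> h; have n16 : 16 <= INR n by have := leq_INR hn; rewrite [INR 16]/=; lra.
have p2 : 0 < 2 ^ n by apply: pow_lt; lra.
have h1 : B * 2 ^ n <= 2 * (5 ^ n * 4 ^ q).
  have -> : 2 ^ n = 2 ^ (n - 2 * q)%nat * 4 ^ q.
    have -> : 4 = 2 ^ 2 by lra.
    by rewrite -pow_mult -pow_add; congr (_ ^ _); rewrite -[RHS]/(n - 2 * q + 2 * q)%nat subnK.
  have : 0 < 4 ^ q by apply: pow_lt; lra.
  by move=> f0; have := Rmult_le_compat_r (4 ^ q) _ _ (Rlt_le _ _ f0) h; lra.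
have h2 : (B * INR n ^ 2) * 2 ^ n <= (3200 * 3 ^ n) * 2 ^ n.
  have -> : 3200 * 3 ^ n * 2 ^ n = 2 * (1600 * 6 ^ n).
    have -> : 6 = 3 * 2 by lra.
    by rewrite Rpow_mult_distr; ring.
  have := Rmult_le_compat_l (INR n ^ 2) _ _ (pow2_ge_0 _) h1; lra.
have h3 := Rmult_le_reg_r _ _ _ p2 h2.
have h4 := cube3_le_ell_INR n; have L0 := ell_gt0 n.
apply: (Rmult_le_reg_r (INR n)); first lra.
have : INR n ^ 2 = INR n * INR n by ring.
nra.
Qed.

(** * Elementary inequalities and the final bounds *)

Lemma cube_ln_le x : 1 <= x -> ln x ^ 3 <= 27 * x.
Proof.
move=> x1; have l0 : 0 <= ln x by rewrite -ln_1; apply: ln_mono; lra.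
have e : exp (ln x / 3) ^ 3 = x.
  rewrite -[RHS]exp_ln; last lra.
  by rewrite /= Rmult_1_r -!exp_plus; congr exp; field.
have h := exp_ineq1_le (ln x / 3).
have : (ln x / 3) ^ 3 <= exp (ln x / 3) ^ 3 by apply: pow_incr; lra.
by rewrite e; lra.
Qed.

(** Turns the error [ln^2 n / n] into the required one. After squaring, it reduces to
    [ln^3 x <= 36 x]. *)
Lemma sqr_ln_le_sqrt x : 1 <= x -> ln x ^ 2 / x <= 6 * sqrt (ln x / x).
Proof.
move=> x1; have h := cube_ln_le x1.
have l0 : 0 <= ln x by rewrite -ln_1; apply: ln_mono; lra.
have ix : 0 < / x by apply: Rinv_0_lt_compat; lra.
have s0 : 0 <= ln x ^ 2 / x / 6 by rewrite /Rdiv; have := pow2_ge_0 (ln x); nra.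
suff : ln x ^ 2 / x / 6 <= sqrt (ln x / x) by lra.
rewrite -(sqrt_pow2 (ln x ^ 2 / x / 6)) //; apply: sqrt_le_1_alt.
have -> : (ln x ^ 2 / x / 6) ^ 2 = (ln x * / x) * (ln x ^ 3 * / x * / 36) by field; lra.
have -> : ln x / x = (ln x * / x) * 1 by rewrite /Rdiv; ring.
apply: Rmult_le_compat_l; first nra.
have : / x * x = 1 by field; lra.
nra.
Qed.

Lemma nat_ceil_exists r : 0 <= r -> exists m : nat, r <= INR m <= r + 1.
Proof.
move=> r0; have [h1 h2] := archimed r; exists (Z.to_nat (up r)).
rewrite INR_IZR_INZ Z2Nat.id; first lra.
by apply: le_IZR; lra.
Qed.

(** Together with [cube3_le_ell] this yields [n <= 16 ell], hence [n/16 <= ell] and [A >= 1]. *)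
Lemma quadratic_le_pow3 n : (2 * INR n + 1) * INR n <= 16 * 3 ^ n.
Proof.
elim: n => [|n IH]; first by rewrite /=; lra.
rewrite S_INR [3 ^ n.+1]/=; have n0 := pos_INR n.
have : 1 <= 3 ^ n by apply: pow_R1_Rle; lra.
case: n n0 IH => [|n] n0 IH; first by rewrite /=; lra.
have n1 : 1 <= INR n.+1 by rewrite S_INR; have := pos_INR n; lra.
nra.
Qed.

Lemma ln_ge1 x : 3 <= x -> 1 <= ln x.
Proof.
move=> x3; rewrite -[1]ln_exp; apply: ln_mono; first exact: exp_pos.
by have := exp_le_3; lra.
Qed.

Lemma ln_antichains_in_typical n (A : R) : (16 <= n)%nat ->
  A = 6 * INR (ell n n) * ln (INR n) / INR (n %/ 16) ->
  1 <= A /\ ln (INR (antichains_in (typical n (n %/ 16)))) <=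
    (INR (ell n n) + A + 1) * ln 2 + 2 * A * ln (INR n).
Proof.
move=> hn; have [q0 _ q16] := sixteenth_bounds hn.
set q := (n %/ 16)%nat in q0 q16 *; set L := INR (ell n n) => eA.
have q1 : 1 <= INR q := leq_INR q0.
have n16 : 16 <= INR n by lra.
have ln1 : 1 <= ln (INR n) by apply: ln_ge1; lra.
have L0 : 0 < L := ell_gt0 n; have hL := cube3_le_ell_INR n; rewrite -/L in hL.
have Lq : INR q <= L.
  have := quadratic_le_pow3 n => h; apply: (Rmult_le_reg_l (2 * INR n + 1)); first lra.
  have : (2 * INR n + 1) * (16 * INR q) <= (2 * INR n + 1) * INR n.
    by apply: Rmult_le_compat_l; lra.
  lra.
have qA : INR q * A = 6 * L * ln (INR n) by rewrite eA; field; lra.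
have A1 : 1 <= A by apply: (Rmult_le_reg_l (INR q)); [lra | rewrite qA; nra].
have [m0 [hm0 hm1]] := @nat_ceil_exists (L + A) ltac:(lra).
split=> //; pose b := rate L A m0.
have A0 : 0 < A by lra.
have b0 i : 0 <= b i by have := rate_bounds i A0 hm0; rewrite -/b; lra.
have main : INR (antichains_in (typical n q)) <= growth b #|typical n q|.
  apply: (antichains_in_growth q0) => // [i j ij | m D /andP[_ hm] deg].
    exact: rate_decr.
  apply: (@rate_step n q m D m0 L A) => //.
  - by rewrite q0 /q leq_div.
  - by have := leq_INR hm; rewrite INR_expn [INR 3]/=; have -> : 1 + 1 + 1 = 3; lra.
  - by have := leq_INR deg; rewrite !INR_muln INR_addn.
(* A generous size past the cutoff, which puts the bound in the form of [ln_growth_rate]. *)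
have size : (#|typical n q| <= m0 + expn 3 n)%nat.
  by rewrite -card_cube3; apply: leq_trans (max_card _) (leq_addl _ _).
have {}main : INR (antichains_in (typical n q)) <= growth b (m0 + expn 3 n)%nat.
  by apply: Rle_trans main _; rewrite -(subnKC size); apply: growth_mono.
have pos : 0 < INR (antichains_in (typical n q)).
  apply: lt_0_INR; apply/ltP/card_gt0P; exists set0.
  by rewrite inE sub0set; apply/antichainP => x y; rewrite inE.
have := ln_mono pos main; have := ln_growth_rate (expn 3 n) A0 hm0; rewrite -/b.
(* It suffices that [m0 + 3^n - L <= n^2 A]: here [m0 - L <= A + 1], and [3^n <= (2n + 1) L] with
   [96 L <= n A]. *)
have ratio : ln (INR (m0 + expn 3 n)%nat - L) - ln A <= 2 * ln (INR n).
  have -> : 2 * ln (INR n) = ln (INR n ^ 2) by rewrite ln_pow_INR; [rewrite /=; lra | lra].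
  suff : ln (INR (m0 + expn 3 n)%nat - L) <= ln (INR n ^ 2 * A).
    by rewrite ln_mult; [lra | apply: pow_lt; lra | lra].
  rewrite INR_addn INR_expn [INR 3]/=; have -> : 1 + 1 + 1 = 3 by lra.
  have p3 : 0 < 3 ^ n by apply: pow_lt; lra.
  apply: ln_mono; first lra.
  have LA : 96 * L <= INR n * A.
    have : L * 1 <= L * ln (INR n) by apply: Rmult_le_compat_l; lra.
    have : 16 * INR q * A <= INR n * A by apply: Rmult_le_compat_r; lra.
    lra.
  have : (2 * INR n + 1) * (96 * L) <= (2 * INR n + 1) * (INR n * A).
    by apply: Rmult_le_compat_l; lra.
  have : 0 <= A * (INR n - 16) * INR n by apply: Rmult_le_pos; [apply: Rmult_le_pos|]; lra.
  have : 0 <= A * (INR n - 16) by apply: Rmult_le_pos; lra.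
  rewrite /=; nra.
have := Rmult_le_compat_l A _ _ (Rlt_le _ _ A0) ratio.
have l2 : 0 < ln 2 by have := ln_lt_2; lra.
have : INR m0 * ln 2 <= (L + A + 1) * ln 2 by apply: Rmult_le_compat_r; lra.
lra.
Qed.

Lemma ln_num_antichains_le n : (16 <= n)%nat ->
  ln (INR (num_antichains n)) / ln 2 / INR (ell n n) - 1 <=
    12000 * (ln (INR n) ^ 2 / INR n).
Proof.
move=> hn; have [A1 typ] := ln_antichains_in_typical hn erefl.
set A := _ / _ in A1 typ; have eA : A = 6 * INR (ell n n) * ln (INR n) / INR (n %/ 16) by [].
clearbody A; have [q0 q32 q16] := sixteenth_bounds hn.
have atyp := atypical_small hn; have L0 := ell_gt0 n.
set q := (n %/ 16)%nat in q0 q32 q16 atyp typ eA; set L := INR (ell n n) in L0 atyp typ eA *.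
set B := INR #|_| in atyp; set l := ln (INR n) in typ eA *.
have q1 : 1 <= INR q := leq_INR q0.
have n16 : 16 <= INR n by lra.
have l1 : 1 <= l by apply: ln_ge1; lra.
have l2 : / 2 < ln 2 by exact: ln_lt_2.
have pN : 0 < INR (num_antichains n).
  by apply: Rlt_le_trans (leq_INR (num_antichains_ge n)); rewrite INR_expn; apply: pow_lt; rewrite /=; lra.
have hN : ln (INR (num_antichains n)) <= B * ln 2 + ((L + A + 1) * ln 2 + 2 * A * l).
  have split_le := leq_INR (num_antichains_split (typical n q)).
  rewrite INR_muln INR_expn -/B [INR 2]/= in split_le.
  have e2 : 1 + 1 = 2 by lra.
  rewrite e2 in split_le; have p2 : 0 < 2 ^ #|~: typical n q| by apply: pow_lt; lra.
  have pT : 0 < INR (antichains_in (typical n q)) by nra.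
  have := ln_mono pN split_le; rewrite ln_mult // ln_pow_INR; last lra.
  by rewrite -/B; lra.
have nA : INR n * A <= 192 * (L * l).
  have -> : 192 * (L * l) = 32 * INR q * A by rewrite eA; field; lra.
  by apply: Rmult_le_compat_r; lra.
apply: (Rmult_le_reg_r (ln 2 * L * INR n)); first by apply: Rmult_lt_0_compat; nra.
have -> : (ln (INR (num_antichains n)) / ln 2 / L - 1) * (ln 2 * L * INR n) =
  (ln (INR (num_antichains n)) - L * ln 2) * INR n by field; lra.
have -> : 12000 * (l ^ 2 / INR n) * (ln 2 * L * INR n) = 12000 * (l * l * L * ln 2) by field; lra.
have h1 := Rmult_le_compat_r (INR n) _ _ ltac:(lra) hN.
have ll : 1 <= l * l by nra.
have Lll : L <= L * (l * l) by nra.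
have Ll : L * l <= L * (l * l) by nra.
(* The atypical points cost 9600, the terms [A] and 1 cost 192 each, and [2 A ln n] costs 768 after
   [ln 2 > 1/2]: in all 10752, below 12000. *)
have i1 : B * INR n * ln 2 <= 9600 * (L * (l * l)) * ln 2 by apply: Rmult_le_compat_r; lra.
have i2 : (INR n * A) * ln 2 <= 192 * (L * (l * l)) * ln 2 by apply: Rmult_le_compat_r; lra.
have i3 : INR n * ln 2 <= INR n * A * ln 2 by apply: Rmult_le_compat_r; nra.
have i4 : (INR n * A) * l <= 192 * (L * (l * l)).
  by have := Rmult_le_compat_r l _ _ ltac:(lra) nA; lra.
have i5 : L * (l * l) * / 2 <= L * (l * l) * ln 2 by apply: Rmult_le_compat_l; lra.
lra.
Qed.

(* log2 (#antichains of {0,1,2}^n) = (1 + O(sqrt(log n / n))) * ell_n(n) as n -> oo *)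
Theorem mainTheorem4 :
  exists C : R, exists N : nat, forall n : nat, (N <= n)%nat ->
    Rabs (ln (INR (num_antichains n)) / ln 2 / INR (ell n n) - 1)
      <= C * sqrt (ln (INR n) / INR n).
Proof.
(* [72000 = 12000 * 6], from [ln_num_antichains_le] and [sqr_ln_le_sqrt]. *)
exists 72000, 16%nat => n hn; have n16 : 16 <= INR n.
  by have [/leq_INR q1 _ ?] := sixteenth_bounds hn; rewrite [INR 1]/= in q1; lra.
have upper := ln_num_antichains_le hn; have root := @sqr_ln_le_sqrt (INR n) ltac:(lra).
have L0 := ell_gt0 n; have l2 : 0 < ln 2 by have := ln_lt_2; lra.
(* The difference is nonnegative because all subsets of the middle level are antichains. *)
rewrite Rabs_right; first lra.
have lower : INR (ell n n) * ln 2 <= ln (INR (num_antichains n)).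
  rewrite -ln_pow_INR; last lra.
  apply: ln_mono; first by apply: pow_lt; lra.
  by have := leq_INR (num_antichains_ge n); rewrite INR_expn [INR 2]/=; have -> : 1 + 1 = 2; lra.
have := Rmult_le_compat_r (/ ln 2 * / INR (ell n n)) _ _ _ lower => h.
suff : 1 <= ln (INR (num_antichains n)) / ln 2 / INR (ell n n) by lra.
have e : INR (ell n n) * ln 2 * (/ ln 2 * / INR (ell n n)) = 1 by field; lra.
rewrite e in h; rewrite /Rdiv Rmult_assoc; apply: h.
by apply: Rmult_le_pos; apply: Rlt_le; apply: Rinv_0_lt_compat.
Qed.
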